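(* Let $A>0$ and suppose $\mathcal{P}=(\mathcal{P}_x)_{x\in\Sigma}$ is a channel satisfying: (C1) $R_{\mathcal{P}}(x^{(1)},x^{(2)})$ is $C^4$ in an open set containing $[-A,A]^2$; (C2) $\frac{\partial^3R_{\mathcal{P}}}{\partial(x^{(1)})^2\,\partial x^{(2)}}(0,0)=0$. Then, for any $\eta\in[0,1]$, the $\eta$-censored channel $\mathcal{C}_\eta\mathcal{P}$ also satisfies (C1) and (C2) (with $R_{\mathcal{C}_\eta\mathcal{P}}$ in place of $R_{\mathcal{P}}$), and has Fisher information $F_{\mathcal{C}_\eta\mathcal{P}}=(1-\eta)F_{\mathcal{P}}$.
   Context: A channel $\mathcal{P}=(\mathcal{P}_x)_{x\in\Sigma}$ is a family of probability measures on a measurable space $\Omega$ indexed by a set $\Sigma\subseteq\mathbb{R}$ containing an open interval around $0$, with $\mathcal{P}_x\ll\mathcal{P}_0$ and $d\mathcal{P}_x/d\mathcal{P}_0\in L^2(\mathcal{P}_0)$ for all $x\in\Sigma$. Channel overlap: $R_{\mathcal{P}}(x^{(1)},x^{(2)})=\mathbb{E}_{y\sim\mathcal{P}_0}\left[\left(\frac{d\mathcal{P}_{x^{(1)}}}{d\mathcal{P}_0}(y)-1\right)\left(\frac{d\mathcal{P}_{x^{(2)}}}{d\mathcal{P}_0}(y)-1\right)\right]$ for $x^{(1)},x^{(2)}\in\Sigma$. Fisher information: $F_{\mathcal{P}}=\frac{\partial^2R_{\mathcal{P}}}{\partial x^{(1)}\partial x^{(2)}}(0,0)$. The $\eta$-censored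 version $\mathcal{C}_\eta\mathcal{P}$ is the channel with range $\Omega\sqcup\{\bullet\}$, for a new symbol $\bullet$, in which a sample from $(\mathcal{C}_\eta\mathcal{P})_x$ is $\bullet$ with probability $\eta$ and a sample from $\mathcal{P}_x$ with probability $1-\eta$. *)

(* Defs.v *)
From HB Require Import structures.
From mathcomp Require Import all_boot all_order all_algebra.
From mathcomp Require Import all_classical all_reals all_analysis.
From mathcomp Require Import measurable_realfun.

Set Implicit Arguments.
Unset Strict Implicit.
Unset Printing Implicit Defensive.

Import Order.TTheory GRing.Theory Num.Theory.
Import numFieldNormedType.Exports.

Local Open Scope classical_set_scope.
Local Open Scope charge_scope.
Local Open Scope ring_scope.

Section likelihood_ratio.
Context d (Omega : measurableType d) (R : realType).

(* For [Q `<< P] the Radon-Nikodym derivative takes finite values everywhere, so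
   [fine] loses nothing. *)
Definition likelihood_ratio (Q P : probability Omega R) (y : Omega) : R :=
  fine (('d (charge_of_finite_measure Q) '/d P) y).

End likelihood_ratio.

(* The family is indexed by all of [R] for convenience only: [law x] is
   unconstrained when [x] is not in [inputs], and is never looked at there (see
   the inclusion of [U] in [conditionC1]). *)
Record channel d (Omega : measurableType d) (R : realType) := Channel {
  inputs : set R ;
  law :> R -> probability Omega R ;
  inputs0 : exists a b : R, [/\ a < 0, 0 < b & `]a, b[%classic `<=` inputs] ;
  law_dominated : forall x, inputs x -> law x `<< law 0 ;
  law_L2 : forall x, inputs x ->
    likelihood_ratio (law x) (law 0) \in Lfun (law 0) 2%:E
}.

Section overlap.
Context d (Omega : measurableType d) (R : realType).

(* The expectation is finite for inputs of the channel, by [law_L2] and the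
   Cauchy-Schwarz inequality. The values are used on [inputs P `*` inputs P]
   only. [R^o * R^o] is the plane as a normed space, as required by ['D_]. *)
Definition overlap (P : channel Omega R) (x : R^o * R^o) : R^o :=
  fine 'E_(P 0)[(fun y : Omega => (likelihood_ratio (P x.1) (P 0) y - 1) *
                        (likelihood_ratio (P x.2) (P 0) y - 1))].

End overlap.

Section plane.
Context (R : realType).
Implicit Types (f : R^o * R^o -> R^o) (U : set (R^o * R^o)).

Definition dir1 : R^o * R^o := (1, 0).
Definition dir2 : R^o * R^o := (0, 1).

Definition partial1 f : R^o * R^o -> R^o := 'D_dir1 f.
Definition partial2 f : R^o * R^o -> R^o := 'D_dir2 f.

(* For an open set [U]: all iterated partial derivatives of order at most [k]
   exist and are continuous on [U]. *)
Fixpoint Ck (k : nat) U f : Prop :=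
  (forall x, U x -> {for x, continuous f}) /\
  if k is k'.+1 then
    [/\ forall x, U x -> derivable f x dir1,
        forall x, U x -> derivable f x dir2,
        Ck k' U (partial1 f) & Ck k' U (partial2 f)]
  else True.

End plane.

Section conditions.
Context d (Omega : measurableType d) (R : realType).
Implicit Types (P : channel Omega R).

Definition fisher P : R := partial1 (partial2 (overlap P)) (0, 0).

Definition conditionC1 (A : R) P : Prop :=
  exists U : set (R^o * R^o),
    [/\ open U, `[- A, A]%classic `*` `[- A, A]%classic `<=` U,
        U `<=` inputs P `*` inputs P & Ck 4 U (overlap P)].

Definition conditionC2 P : Prop :=
  partial1 (partial1 (partial2 (overlap P))) (0, 0) = 0.

End conditions.

(* [option T] is the disjoint union of [T] and a new symbol [None], with the
   disjoint-union sigma-algebra; [None] is the censoring symbol. *)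
Definition option_display : measure_display -> measure_display.
Proof. exact. Qed.

Section option_measurable.
Context d (T : measurableType d).

Definition option_measurable : set (set (option T)) :=
  [set A | measurable (Some @^-1` A)].

Let option_measurable0 : option_measurable set0.
Proof. by rewrite /option_measurable/= preimage_set0. Qed.

Let option_measurableC A : option_measurable A -> option_measurable (~` A).
Proof. by rewrite /option_measurable/= preimage_setC; exact: measurableC. Qed.

Let option_measurable_bigcup (F : (set (option T))^nat) :
  (forall i, option_measurable (F i)) -> option_measurable (\bigcup_i F i).
Proof.
by move=> mF; rewrite /option_measurable/= preimage_bigcup; exact: bigcupT_measurable.
Qed.

HB.instance Definition _ := @isMeasurable.Build (option_display d) (option T)
  option_measurable option_measurable0 option_measurableC
  option_measurable_bigcup.

Let measurable_Some : measurable_fun [set: T] (Some : T -> option T).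
Proof. by move=> _ A mA; rewrite setTI. Qed.

HB.instance Definition _ := isMeasurableFun.Build _ _ T (option T) (@Some T)
  measurable_Some.

Lemma measurable_image_Some (A : set T) :
  measurable A -> measurable (Some @` A).
Proof.
move=> mA; rewrite /measurable/= /option_measurable/=.
suff -> : Some @^-1` (Some @` A) = A by [].
by apply/seteqP; split => [x [y Ay [<-]]//|x Ax]; exists x.
Qed.

End option_measurable.

Section censor_prob.
Context d (T : measurableType d) (R : realType).
Variables (eta : {i01 R}) (P : probability T R).
Local Open Scope ereal_scope.

Definition censor_prob : set (option T) -> \bar R :=
  measure_add (mscale (eta%:num%:nng)%R \d_None)
    (mscale ((1 - eta%:num)%:nng)%R (distribution P (@Some T))).

HB.instance Definition _ := Measure.on censor_prob.

Lemma censor_probE A : censor_prob A =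
  (eta%:num)%R%:E * \d_None A + (1 - eta%:num)%R%:E * P (Some @^-1` A).
Proof. by rewrite /censor_prob measure_addE. Qed.

Let censor_prob_setT : censor_prob [set: option T] = 1.
Proof.
rewrite censor_probE diracT preimage_setT probability_setT !mule1 -EFinD.
by rewrite addrC subrK.
Qed.

HB.instance Definition _ := Measure_isProbability.Build _ _ _ censor_prob
  censor_prob_setT.

Lemma ge0_integral_censor_prob (G : option T -> \bar R) :
  measurable_fun [set: option T] G -> (forall z, 0 <= G z) ->
  \int[censor_prob]_z G z =
  (eta%:num)%R%:E * G None + (1 - eta%:num)%R%:E * \int[P]_y G (Some y).
Proof.
move=> mG G0; rewrite /censor_prob ge0_integral_measure_add//.
rewrite !ge0_integral_mscale//= integral_dirac// diracT mul1e.
by rewrite (@ge0_integral_distribution _ _ _ _ _ P (@Some T)).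
Qed.

Lemma ge0_integral_censor_prob_Some (A : set T) (G : option T -> \bar R) :
  measurable A -> measurable_fun [set: option T] G -> (forall z, 0 <= G z) ->
  \int[censor_prob]_(z in Some @` A) G z =
  (1 - eta%:num)%R%:E * \int[P]_(y in A) G (Some y).
Proof.
move=> mA mG G0; have mSA := measurable_image_Some mA.
rewrite integral_mkcond ge0_integral_censor_prob; last 2 first.
- by apply/(measurable_restrictT _ mSA)/measurable_funTS.
- by move=> z; rewrite erestrict_ge0.
rewrite [X in _ * X + _]patchE memNset; last by case.
rewrite mule0 add0e [in RHS]integral_mkcond; congr (_ * _).
apply: eq_integral => y _; rewrite !patchE.
case: ifPn => [/set_mem[z Az [<-]]|/negP yA]; first by rewrite mem_set.
by rewrite memNset// => Ay; apply: yA; rewrite inE; exists y.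
Qed.

Lemma integrable_censor_prob_Some (G : option T -> \bar R) :
  (eta%:num < 1)%R -> censor_prob.-integrable [set: option T] G ->
  P.-integrable [set: T] (G \o @Some T).
Proof.
move=> eta1 /integrableP[mG Goo].
have mGS : measurable_fun [set: T] (G \o @Some T) by exact: measurableT_comp.
apply/integrableP; split => //; move: Goo.
rewrite ge0_integral_censor_prob//; last exact: measurableT_comp.
rewrite !ltNge; apply: contra; rewrite !leye_eq => /eqP /= ->.
by rewrite gt0_muley ?lte_fin ?subr_gt0// addey// -ltNye (@lt_le_trans _ _ 0)// mule_ge0.
Qed.

Lemma integral_censor_prob_Some (A : set T) (G : option T -> \bar R) :
  (eta%:num < 1)%R ->
  measurable A -> censor_prob.-integrable [set: option T] G ->
  \int[censor_prob]_(z in Some @` A) G z =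
  (1 - eta%:num)%R%:E * \int[P]_(y in A) G (Some y).
Proof.
move=> eta1 mA iG; have iGS := integrable_censor_prob_Some eta1 iG.
have mG := measurable_int _ iG.
rewrite integralE !ge0_integral_censor_prob_Some//; last 2 first.
- exact: measurable_funeneg.
- exact: measurable_funepos.
rewrite [in RHS]integralE [RHS]muleBr//; last first.
  apply: fin_num_adde_defr.
  by apply: integrable_pos_fin_num => //; exact: integrableS iGS.
by rewrite (funepos_comp G (@Some T)) (funeneg_comp G (@Some T)).
Qed.

End censor_prob.

Lemma Lfun2P d (T : measurableType d) (R : realType)
    (mu : {measure set T -> \bar R}) (f : T -> R) :
  measurable_fun [set: T] f ->
  (f \in Lfun mu 2%:E) <-> (\int[mu]_x (f x ^+ 2)%:E < +oo)%E.
Proof.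
move=> mf; split=> [/Lfun2_integrable_sqr/integrableP[_]|foo].
  by under eq_integral => x _ do rewrite gee0_abs ?lee_fin ?sqr_ge0//=.
rewrite inE; apply/andP; split; rewrite inE//= /finite_norm unlock poweR_lty//.
under eq_integral => x _ do rewrite /= powR_mulrn// real_normK ?num_real//.
exact: foo.
Qed.

Section censor.
Context d (Omega : measurableType d) (R : realType).
Variables (eta : {i01 R}).

Lemma censor_prob_dominated (Q P : probability Omega R) :
  Q `<< P -> censor_prob eta Q `<< censor_prob eta P.
Proof.
move=> /null_content_dominatesP QP; apply/null_content_dominatesP => A mA.
rewrite [LHS]censor_probE censor_probE => /eqP.
rewrite padde_eq0 ?mule_ge0// => /andP[/eqP -> ]; rewrite add0e.
by rewrite mule_eq0 => /orP[/eqP ->|/eqP /QP ->//]; rewrite ?mul0e ?mule0.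
Qed.

Lemma likelihood_ratio_censor_prob (Q P : probability Omega R) :
  (eta%:num < 1)%R -> Q `<< P ->
  {ae P, forall y, likelihood_ratio (censor_prob eta Q) (censor_prob eta P)
    (Some y) = likelihood_ratio Q P y}.
Proof.
move=> eta1 QP; have cQP := censor_prob_dominated QP.
pose g := 'd (charge_of_finite_measure (censor_prob eta Q)) '/d
  (censor_prob eta P).
pose f := 'd (charge_of_finite_measure Q) '/d P.
have ig : (censor_prob eta P).-integrable [set: option Omega] g.
  exact: Radon_Nikodym_integrable.
have igS := integrable_censor_prob_Some eta1 ig.
have : ae_eq P setT (g \o @Some Omega) f.
  apply: integral_ae_eq => //.
    exact: measurable_int (@Radon_Nikodym_integrable _ _ _
      (charge_of_finite_measure Q) P QP).
  move=> E _ mE; rewrite -Radon_Nikodym_integral//.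
  have mSE := measurable_image_Some mE.
  have := @Radon_Nikodym_integral _ _ _
    (charge_of_finite_measure (censor_prob eta Q)) (censor_prob eta P) _
    cQP mSE.
  rewrite integral_censor_prob_Some// [X in X = _ -> _]censor_probE.
  rewrite diracE memNset ?mule0 ?add0e; last by case.
  have -> : Some @^-1` (Some @` E) = E.
    by apply/seteqP; split => [y [z Ez [<-]]//|y Ey]; exists y.
  have eta0 : (1 - eta%:num != 0)%R by rewrite subr_eq0 gt_eqF.
  move/(congr1 (fun x => (1 - eta%:num)^-1%:E * x)%E).
  by rewrite !muleA -EFinM mulVf// !mul1e.
apply: filterS => y /(_ I) gf; rewrite /likelihood_ratio -/g -/f -gf//.
Qed.

Lemma censor_prob_L2 (Q P : probability Omega R) : Q `<< P ->
  likelihood_ratio Q P \in Lfun P 2%:E ->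
  likelihood_ratio (censor_prob eta Q) (censor_prob eta P)
    \in Lfun (censor_prob eta P) 2%:E.
Proof.
move=> QP.
have mlr d' (T : measurableType d') (Q' P' : probability T R) : Q' `<< P' ->
    measurable_fun [set: T] (likelihood_ratio Q' P').
  by move=> QP'; exact: measurableT_comp.
have mQP := mlr _ _ _ _ QP.
have mcQP := mlr _ _ _ _ (censor_prob_dominated QP).
move=> /(Lfun2P _ mQP) QPoo; apply/(Lfun2P _ mcQP).
have msq d' (T : measurableType d') (h : T -> R) : measurable_fun [set: T] h ->
    measurable_fun [set: T] (fun x => (h x ^+ 2)%:E).
  by move=> mh; apply/measurable_EFinP; exact: measurable_funX.
rewrite ge0_integral_censor_prob; last 2 first.
- exact: msq.
- by move=> z; rewrite lee_fin sqr_ge0.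
apply: lte_add_pinfty; first by rewrite -EFinM ltry.
have [eta1|eta1] := ltP (eta%:num) 1; last first.
  suff -> : eta%:num = 1 by rewrite subrr mul0e ltry.
  by apply/eqP; rewrite eq_le eta1 andbT.
rewrite lte_mul_pinfty ?lee_fin ?subr_ge0 ?(ltW eta1)//.
rewrite (_ : (\int[P]_y _)%E = \int[P]_y (likelihood_ratio Q P y ^+ 2)%:E)%E//.
apply: ae_eq_integral => //.
- by apply: msq; exact: (measurableT_comp mcQP).
- exact: msq.
- by apply: filterS (likelihood_ratio_censor_prob eta1 QP) => y /= ->.
Qed.

Definition censor (P : channel Omega R) : channel (option Omega) R :=
  @Channel _ (option Omega) R (inputs P)
    (fun x => censor_prob eta (P x)) (inputs0 P)
    (fun x Px => censor_prob_dominated (law_dominated Px))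
    (fun x Px => censor_prob_L2 (law_dominated Px) (law_L2 Px)).

End censor.

(* Main.v *)
Require Import Defs.
From HB Require Import structures.
From mathcomp Require Import all_boot all_order all_algebra.
From mathcomp Require Import all_classical all_reals all_analysis.
From mathcomp Require Import measurable_realfun.

Import Order.TTheory GRing.Theory Num.Theory.
Import numFieldNormedType.Exports.

Local Open Scope classical_set_scope.
Local Open Scope ring_scope.

(** Censoring turns an observation into one that is lost with probability
[eta], and a lost observation carries no information about the input: every
law of the censored channel gives the mass [eta] to the symbol [None], so the
likelihood ratio is [1] there as soon as [eta] is not [0]. On the other
symbols, which have probability [0] if [eta = 1], the factor [1 - eta] cancels
from the likelihood ratio, which is thus almost everywhere the one of the
original channel. In the expectation that
defines the overlap, the symbol [None] therefore contributes [0], and the rest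
is the original expectation weighted by [1 - eta]: on pairs of inputs of the
channel, the overlap of the censored channel is [1 - eta] times the overlap of
the channel ([overlap_censor]).

The three claims then follow because differentiation is linear and local: on
an open set of pairs of inputs the two overlaps are proportional, so all
partial derivatives of the original overlap carry over to the censored one,
with the same factor ([Ck_scale], [partial_scale]). The
origin belongs to the open set of the smoothness condition, hence the
vanishing third derivative still vanishes and the Fisher information is
multiplied by [1 - eta]. *)

Section integral_censor.
Context d (T : measurableType d) (R : realType).
Implicit Types (eta : {i01 R}) (P Q : probability T R).
Local Open Scope charge_scope.
Local Open Scope ereal_scope.

(** A nonnegative real factor distributes even over an undefined difference:
with the convention [+oo - +oo = -oo], both sides are [-oo], or [0] when the
factor vanishes. *)
Lemma EFin_ge0_muleBr (k : R) (x y : \bar R) : (0 <= k)%R -> 0 <= y ->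
  k%:E * (x - y) = k%:E * x - k%:E * y.
Proof.
rewrite le_eqVlt => /predU1P[<- _|k0]; first by rewrite !mul0e subee.
case: y => [y| |//] _; first by rewrite muleBr// fin_num_adde_defl.
by rewrite gt0_muley ?lte_fin// !addeNy gt0_muleNy ?lte_fin.
Qed.

(** An infinite [x] is no exception, since [fine] maps infinities to [0]. *)
Lemma fine_EFinM (k : R) (x : \bar R) : fine (k%:E * x) = (k * fine x)%R.
Proof.
case: x => [x| |]; first by rewrite -EFinM.
- by rewrite mulr0 mulry; case: (sgrP k) => _; rewrite ?mul0e ?mul1e ?mulN1e.
- by rewrite mulr0 mulrNy; case: (sgrP k) => _; rewrite ?mul0e ?mul1e ?mulN1e.
Qed.

(** The hypothesis on [G None] says that the atom at [None] contributes
nothing. It does so for the positive and for the negative part of [G], and the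
difference of the two integrals commutes with the weight [1 - eta] even when
both are infinite ([EFin_ge0_muleBr]). *)
Lemma integral_censor_prob {eta P} {G : option T -> \bar R} :
  measurable_fun [set: option T] G -> eta%:num%:E * G None = 0 ->
  \int[censor_prob eta P]_z G z =
  (1 - eta%:num)%:E * \int[P]_y G (Some y).
Proof.
move=> mG /eqP; rewrite mule_eq0 eqe => G0.
have part (H : option T -> \bar R) : measurable_fun setT H ->
    (forall z, 0 <= H z) -> (G None = 0 -> H None = 0) ->
    \int[censor_prob eta P]_z H z = (1 - eta%:num)%:E * \int[P]_y H (Some y).
  move=> mH H0 GH; rewrite ge0_integral_censor_prob//.
  by case/orP: G0 => [/eqP ->|/eqP/GH ->]; rewrite ?mul0e ?mule0 add0e.
rewrite integralE [in RHS]integralE (funepos_comp G (@Some T)).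
rewrite (funeneg_comp G (@Some T)) EFin_ge0_muleBr; last 2 first.
- by [].
- by apply: integral_ge0 => y _; exact: funeneg_ge0.
congr (_ - _); apply: part => //.
- exact: measurable_funepos.
- by rewrite funeposE => ->; rewrite maxxx.
- exact: measurable_funeneg.
- by rewrite funenegE => ->; rewrite oppe0 maxxx.
Qed.

(** Both laws give the mass [eta] to [None], whence [eta * g None = eta] for
the density [g]. *)
Lemma likelihood_ratio_censor_None {eta Q P} : Q `<< P ->
  (eta%:num * (likelihood_ratio (censor_prob eta Q) (censor_prob eta P) None
    - 1))%R = 0%R.
Proof.
move=> QP; have cQP := censor_prob_dominated (eta := eta) QP.
have SomeN : Some @^-1` [set None] = set0 :> set T by apply/seteqP; split.
have mN : measurable [set None : option T].
  by rewrite /measurable/= /option_measurable/= SomeN.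
have cN P' : censor_prob eta P' [set None] = eta%:num%:E.
  by rewrite censor_probE diracE mem_set// mule1 SomeN measure0 mule0 adde0.
have := @Radon_Nikodym_integral _ _ _
  (charge_of_finite_measure (censor_prob eta Q)) (censor_prob eta P) _ cQP mN.
set g := 'd _ '/d _; rewrite [X in X = _ -> _]cN.
rewrite (eq_integral (cst (g None))); last by move=> z /set_mem ->.
rewrite integral_cst// [X in _ = _ * X -> _]cN.
have gfin : g None \is a fin_num by exact: Radon_Nikodym_fin_num.
rewrite -(fineK gfin) -EFinM => -[].
rewrite -[fine _]/(likelihood_ratio _ _ None) => etaE.
by rewrite mulrBr mulr1 mulrC -etaE subrr.
Qed.

Lemma measurable_likelihood_ratio {Q P} : Q `<< P ->
  measurable_fun [set: T] (likelihood_ratio Q P).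
Proof. by move=> QP; exact: measurableT_comp. Qed.

End integral_censor.

(** The atom at [None] contributes nothing as the likelihood ratio is [1]
there, or has weight [0]; elsewhere the two likelihood ratios agree almost
everywhere. *)
Lemma overlap_censor d (Omega : measurableType d) (R : realType)
    (eta : {i01 R}) (P : channel Omega R) (x : R^o * R^o) :
  (inputs P `*` inputs P) x ->
  overlap (censor eta P) x = (1 - eta%:num) * overlap P x.
Proof.
move=> [/= /law_dominated dom1 /law_dominated dom2].
have cdom1 := censor_prob_dominated (eta := eta) dom1.
have cdom2 := censor_prob_dominated (eta := eta) dom2.
have mG d' (T : measurableType d') (Q1 Q2 Q0 : probability T R) :
    Q1 `<< Q0 -> Q2 `<< Q0 -> measurable_fun [set: T] (fun y =>
      ((likelihood_ratio Q1 Q0 y - 1) * (likelihood_ratio Q2 Q0 y - 1))%:E).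
  move=> Q10 Q20; apply/measurable_EFinP; apply: measurable_funM;
    by apply: measurable_funB => //; exact: measurable_likelihood_ratio.
rewrite /overlap unlock /= integral_censor_prob; last 2 first.
- exact: mG.
- by rewrite -EFinM mulrA likelihood_ratio_censor_None// mul0r.
(* For [eta = 1] the likelihood ratios at [Some y] are arbitrary, but their
   weight is [0]. *)
have [eta1|eta1] := ltP eta%:num 1; last first.
  have -> : eta%:num = 1 by apply/eqP; rewrite eq_le eta1 andbT.
  by rewrite subrr mul0e mul0r.
rewrite fine_EFinM; congr (_ * fine _).
apply: ae_eq_integral; [exact: measurableT|..].
- exact: (measurableT_comp (mG _ _ _ _ _ cdom1 cdom2)).
- exact: mG.
have lr1 := likelihood_ratio_censor_prob eta1 dom1.
have lr2 := likelihood_ratio_censor_prob eta1 dom2.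
by apply: filterS2 lr1 lr2 => y /= -> ->.
Qed.

Section proportional.
Context {R : realType} {k : R} {U : set (R^o * R^o)} (oU : open U).
Implicit Types f g : R^o * R^o -> R^o.

Definition proportional_on f g := forall x, U x -> f x = k * g x.

Lemma near_proportional {f g x} : proportional_on f g -> U x ->
  \near x, (k \*: g) x = f x.
Proof.
by move=> fg Ux; apply: filterS (open_nbhs_nbhs (conj oU Ux)) => y /fg ->.
Qed.

Lemma continuous_scale {f g x} : proportional_on f g -> U x ->
  {for x, continuous g} -> {for x, continuous f}.
Proof.
move=> fg Ux cg; rewrite /prop_for /continuous_at [f x]fg//.
apply: cvg_trans (near_eq_cvg (near_proportional fg Ux)) _.
by apply: cvgZ; [exact: cvg_cst|exact: cg].
Qed.

Lemma derivable_scale {f g v x} : proportional_on f g -> U x ->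
  derivable g x v -> derivable f x v.
Proof.
move=> fg Ux gv; apply: near_eq_derivable (near_proportional fg Ux) _.
exact: derivableZ.
Qed.

(** A derivative at a point of [U] depends on the function near that point
only, so the conclusion has the form of the hypothesis and the lemma can be
iterated. *)
Lemma partial_scale {f g v} : proportional_on f g ->
  (forall x, U x -> derivable g x v) -> proportional_on ('D_v f) ('D_v g).
Proof.
move=> fg gv x Ux; rewrite -(near_eq_derive _ (near_proportional fg Ux)).
by rewrite deriveZ//; exact: gv.
Qed.

Lemma Ck_scale {n f g} : proportional_on f g -> Ck n U g -> Ck n U f.
Proof.
elim: n f g => [|n IH] f g fg [cg Dg]; split => //.
- by move=> x Ux; exact: continuous_scale fg Ux (cg _ Ux).
- by move=> x Ux; exact: continuous_scale fg Ux (cg _ Ux).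
- case: Dg => D1 D2 C1 C2; split.
  + by move=> x Ux; exact: derivable_scale fg Ux (D1 _ Ux).
  + by move=> x Ux; exact: derivable_scale fg Ux (D2 _ Ux).
  + exact: IH (partial_scale fg D1) C1.
  + exact: IH (partial_scale fg D2) C2.
Qed.

End proportional.

Theorem theorem3p28 (d : measure_display) (Omega : measurableType d)
    (R : realType) (A : R) (A_gt0 : 0 < A) (P : channel Omega R)
    (P_C1 : conditionC1 A P) (P_C2 : conditionC2 P) (eta : {i01 R}) :
  [/\ conditionC1 A (censor eta P),
      conditionC2 (censor eta P)
    & fisher (censor eta P) = (1 - eta%:num) * fisher P].
Proof.
case: P_C1 => U [oU AU UP CU].
have U0 : U (0, 0).
  by apply: AU; split; rewrite /= in_itv/= oppr_le0 ltW.
have E0 : @proportional_on _ (1 - eta%:num) U (overlap (censor eta P))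
    (overlap P).
  by move=> x /UP; exact: overlap_censor.
(* The derivability of the partial derivatives along the path to the third
   derivative of the second condition is read off the smoothness of order 4. *)
have CU' := CU; case: CU => _ [_ D2 _ [_ [D12 _ [_ [D112 _ _ _]] _]]].
have E2 := partial_scale oU E0 D2.
have E12 := partial_scale oU E2 D12.
have E112 := partial_scale oU E12 D112.
split; last exact: E12 U0.
- exists U; split; [exact: oU|exact: AU|exact: UP|exact (Ck_scale oU E0 CU')].
- by rewrite /conditionC2 [LHS](E112 _ U0) [X in _ * X]P_C2 mulr0.
Qed.
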